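(* Let $n\in\mathbb{N}$ with $n\ge 1$, let $\mathcal{F}\subseteq\mathbb{R}^n$ and let $h\in\mathbb{R}^n$. Then $h\in\operatorname{conv}(\mathcal{F})$ if and only if there are sets $S_1,\ldots,S_n\in\bar{\mathcal{L}}^{U}$ such that $\bar\mu^{U}(S_i)=h_i$ for all $i\in\{1,\ldots,n\}$ and $\bar\varphi^{U}(t,S_1,\ldots,S_n)\in\operatorname{conv}(\mathcal{F})$ for every $t\in U$.
   Context: Let $U=[0,1)$. A rectangle over $U$ is a pair $R=([a,b),c)$ with $[a,b)\subseteq U$, $a<b$, $c\in\mathbb{R}$, $c\neq 0$; let $\mathcal{R}^U$ be the set of all of them. Put $q(R)=(b-a)c$ (signed area) and $z(R)=c$ (signed height). For $t\in U$ let $y(t,R)=1$ if $a\le t<b$ ($R$ is active at $t$) and $y(t,R)=0$ otherwise. Two rectangles $R_1,R_2$ are non-overlapping if there is no $t\in U$ with $y(t,R_1)=y(t,R_2)=1$. $\bar{\mathcal{L}}^U$ is the set of all finite (possibly empty) families $S=\{R_1,\ldots,R_k\}$ of pairwise non-overlapping rectangles from $\mathcal{R}^U$, $k\in\mathbb{N}$ (with $0\in\mathbb{N}$). For such $S$, $\bar\mu^U(S)=\sum_{i=1}^k q(R_i)$. For $t\in U$ and $S\in\bar{\mathcal{L}}^U$, $\bar\phi^U(t,S)=z(R)$ if some (necessarily unique) $R\in S$ is active at $t$, and $\bar\phi^U(t,S)=0$ otherwise. Finally, $\bar\varphi^U(t,S_1,\ldots,S_n)=(\bar\phi^U(t,S_1),\ldots,\bar\phi^U(t,S_n))\in\mathbb{R}^n$.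 *)

(* Defs.v *)
From mathcomp Require Import all_boot all_order all_algebra finmap.
From mathcomp Require Import boolp classical_sets set_interval reals convex.

Set Implicit Arguments.
Unset Strict Implicit.
Unset Printing Implicit Defensive.

Import Order.TTheory GRing.Theory Num.Theory.

Local Open Scope classical_set_scope.
Local Open Scope ring_scope.

Definition convex_hull (R : realType) (V : lmodType R) (F : set V) : set V :=
  smallest (@convex_set R V) F.

Definition U (R : realType) : set R := `[0, 1[.
Arguments U : clear implicits.

(* The triple ((a, b), c) encodes ([a, b), c). Membership in the set of
   rectangles over U is the separate predicate [rectangles]. *)
Definition rect (R : realType) : Type := ((R * R) * R)%type.

Section Rectangles.
Variable R : realType.
Implicit Types (r : rect R) (S : {fset rect R}) (t : R).

Definition left_end r : R := r.1.1.
Definition right_end r : R := r.1.2.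
Definition height r : R := r.2.

Definition rectangles : set (rect R) :=
  [set r | [/\ `[left_end r, right_end r[ `<=` U R,
               left_end r < right_end r & height r != 0]].

Definition area r : R := (right_end r - left_end r) * height r.

Definition active t r : bool := left_end r <= t < right_end r.

Definition non_overlapping r1 r2 : Prop :=
  ~ exists t, [/\ U R t, active t r1 & active t r2].

Definition families : set {fset rect R} :=
  [set S | (forall r, r \in S -> rectangles r) /\
           (forall r1 r2, r1 \in S -> r2 \in S -> r1 != r2 ->
              non_overlapping r1 r2)].

Definition mu S : R := \sum_(r <- S) area r.

(* [pick] is canonical for S in [families]: at most one rectangle of such an S
   is active at a given t in U. *)
Definition phi t S : R :=
  if [pick r : S | active t (val r)] is Some r then height (val r) else 0.

Definition varphi (n : nat) t (S : 'I_n -> {fset rect R}) : 'rV[R]_n :=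
  \row_i phi t (S i).

End Rectangles.

(* Main.v *)
Require Import Defs.
From mathcomp Require Import all_boot all_order all_algebra finmap.
From mathcomp Require Import boolp classical_sets set_interval reals convex.
From mathcomp Require Import interval_inference lra.

(** The vector-valued step function t |-> varphi t S takes its values in the
    convex set conv F, and mu S is its integral over [0, 1); so the theorem says
    that the mean of a step function stays in any convex set containing its
    values, and that every point of the set is such a mean.

    A point h is the mean of the constant function h: a single rectangle of
    height h_i over [0, 1) for each nonzero coordinate (lemmas about [slab]).

    For the converse, let G be the indefinite integral of the step function
    ([sweep], taken coordinatewise). Then G has chord slope (G y - G x) / (y - x)
    in conv F as soon as no rectangle starts or ends strictly between x and y,
    since the step function is constant there ([sweepB]). The slope over [x, z]
    is a convex combination of the slopes over [x, y] and [y, z]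
    ([slope_in_trans]), hence, cutting [0, 1] at the finitely many end points,
    the slope over [0, 1] lies in conv F as well ([slope_in_cut]). That slope is
    G 1 - G 0 = h. *)

Set Implicit Arguments.
Unset Strict Implicit.
Unset Printing Implicit Defensive.

Import Order.TTheory GRing.Theory Num.Theory.

Local Open Scope classical_set_scope.
Local Open Scope ring_scope.

Section Convex.
Variables (R : realType) (V : lmodType R).
Implicit Types (C F : set V) (G : R -> V) (x y z : R).

Lemma convex_setD C (k l : R) (a b : V) :
  @convex_set R V C -> 0 <= k -> 0 <= l -> k + l = 1 ->
  C a -> C b -> C (k *: a + l *: b).
Proof.
move=> cC k0 l0 kl Ca Cb.
have k1 : k <= 1 by rewrite -kl lerDl.
have := cC a b (Itv01 k0 k1) (mem_set Ca) (mem_set Cb).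
by rewrite inE /conv /= /unstable.onem -kl [k + l]addrC addrK.
Qed.

Lemma convex_set_hull F : @convex_set R V (convex_hull F).
Proof.
move=> a b k /set_mem Ca /set_mem Cb; apply/mem_set => A [cA FA]; apply/set_mem.
by apply: (cA); apply/mem_set; [exact: Ca | exact: Cb].
Qed.

Definition slope_in C G x y : Prop :=
  exists2 v, C v & G y - G x = (y - x) *: v.

Lemma slope_in_trans C G x y z : @convex_set R V C -> x < y -> y < z ->
  slope_in C G x y -> slope_in C G y z -> slope_in C G x z.
Proof.
move=> cC xy yz [u Cu Gu] [v Cv Gv].
have xz : 0 < z - x by lra.
exists (((y - x) / (z - x)) *: u + ((z - y) / (z - x)) *: v).
  apply: convex_setD => //; try by apply: divr_ge0; lra.
  by rewrite -mulrDl addrC subrKA divff ?gt_eqF.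
rewrite scalerDr !scalerA !(mulrC (z - x)) !divfK ?gt_eqF//.
by rewrite -Gu -Gv [RHS]addrC addrA subrK.
Qed.

(** Induction on the list of cut points: the head either splits [x, y] in two,
    and slopes combine by [slope_in_trans], or does not separate x from y. *)
Lemma slope_in_cut C G (s : seq R) x y : @convex_set R V C -> x < y ->
  (forall u v, x <= u -> u < v -> v <= y ->
     {in s, forall e, ~~ (u < e < v)} -> slope_in C G u v) ->
  slope_in C G x y.
Proof.
move=> cC; elim: s x y => [|e s IHs] x y xy Hs; first exact: Hs.
have [/andP[xe ey]|exy] := boolP (x < e < y).
  apply: (slope_in_trans cC xe ey); apply: IHs => // u v xu uv vy su;
    apply: Hs => //; try lra.
    move=> e'; rewrite inE => /predU1P[->|]; last exact: su.
    by apply/negP; lra.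
  move=> e'; rewrite inE => /predU1P[->|]; last exact: su.
  by apply/negP; lra.
apply: IHs => // u v xu uv vy su; apply: Hs => // e'.
rewrite inE => /predU1P[->|]; last exact: su.
by apply: contra exy => /andP[ue ev]; apply/andP; split; lra.
Qed.

End Convex.

Section StepFunctions.
Variable R : realType.
Implicit Types (r : rect R) (S : {fset rect R}) (t x y c : R).

Lemma rectangles_bounds r : rectangles r ->
  [/\ 0 <= left_end r, left_end r < right_end r & right_end r <= 1].
Proof.
case=> sub ab _; have UP t : left_end r <= t < right_end r -> 0 <= t < 1.
  by move=> tr; have := sub t; rewrite /U /= !in_itv /=; apply.
split=> //.
  by have /UP/andP[] : left_end r <= left_end r < right_end r by rewrite lexx.
rewrite leNgt; apply/negP => b1.
(* If the right end exceeded 1, this point would lie in the rectangle's base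
   but not in [0, 1). *)
have := UP (Num.max (left_end r) 1).
by rewrite le_max lexx gt_max ab b1 => /(_ isT); rewrite gt_max ltxx !andbF.
Qed.

(** The sum form makes [phi] additive over rectangles, like [sweep]: by
    non-overlapping, only the picked rectangle contributes. *)
Lemma phiE t S : families S -> U R t ->
  phi t S = \sum_(r <- S) if active t r then height r else 0.
Proof.
move=> [_ disj] Ut; rewrite /phi; case: pickP => [r tr | no].
  rewrite (big_fsetD1 (val r)) ?(valP r)//= tr big1_seq ?addr0// => r' /=.
  rewrite in_fsetD1 => /andP[rr' r'S]; case: ifP => // tr'.
  by case: (disj _ _ r'S (valP r) rr'); exists t.
rewrite big1_seq// => r /= rS.
by have /= -> := no [` rS]%fset.
Qed.

(** The signed area of the part of S to the left of x, that is, the integral of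
    [phi] from 0 to x. *)
Definition sweep S x : R :=
  \sum_(r <- S)
     (Num.min (right_end r) x - Num.min (left_end r) x) * height r.

Lemma sweep0 S : families S -> sweep S 0 = 0.
Proof.
move=> [rS _]; rewrite /sweep big1_seq// => r /= /rS/rectangles_bounds[a0 ab _].
by rewrite !min_r ?subrr ?mul0r//; lra.
Qed.

Lemma sweep1 S : families S -> sweep S 1 = mu S.
Proof.
move=> [rS _]; apply: eq_big_seq => r /rS/rectangles_bounds[a0 ab b1].
by rewrite !min_l//; lra.
Qed.

Definition ends S : seq R :=
  [seq left_end r | r <- S] ++ [seq right_end r | r <- S].

Lemma minrB_no_cut e x y : x < y -> ~~ (x < e < y) ->
  Num.min e y - Num.min e x = if x < e then y - x else 0.
Proof.
move=> xy; case: (ltP x e) => /= [xe|ex _].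
  by rewrite -leNgt => ye; rewrite !min_r//; lra.
by rewrite !min_l ?subrr//; lra.
Qed.

(** Without end points inside (x, y), the two minima of a summand of [sweep]
    grow by y - x if the corresponding end exceeds x, and by 0 otherwise. These
    growths differ exactly when the rectangle is active at x. *)
Lemma sweepB S x y : families S -> U R x -> x < y ->
  {in ends S, forall e, ~~ (x < e < y)} ->
  sweep S y - sweep S x = (y - x) * phi x S.
Proof.
move=> fS Ux xy cut; rewrite phiE// /sweep -sumrB mulr_sumr.
apply: eq_big_seq => r rS; have [_ ab _] := rectangles_bounds (fS.1 _ rS).
have cutl := cut (left_end r); have cutr := cut (right_end r).
rewrite !mem_cat !map_f ?orbT// in cutl cutr.
rewrite -mulrBl opprD addrACA -opprD.
rewrite !minrB_no_cut ?cutl ?cutr// /active.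
have [xa|ax] := ltP x (left_end r).
  by rewrite (lt_trans xa ab) subrr mul0r mulr0.
by case: ifP => /= _; rewrite subr0 ?mul0r ?mulr0.
Qed.

Definition slab c : {fset rect R} :=
  if c == 0 then fset0 else [fset ((0, 1), c)]%fset.

Lemma families_slab c : families (slab c).
Proof.
rewrite /slab; case: eqVneq => [_|c0]; first by split=> r; rewrite in_fset0.
split=> [r | r1 r2]; first by move/fset1P ->; split.
by move=> /fset1P -> /fset1P ->; rewrite eqxx.
Qed.

Lemma mu_slab c : mu (slab c) = c.
Proof.
rewrite /mu /slab; case: eqVneq => [->|_].
  by rewrite big_seq_fset0.
by rewrite big_seq_fset1 /area /left_end /right_end /height /= subr0 mul1r.
Qed.

Lemma phi_slab t c : U R t -> phi t (slab c) = c.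
Proof.
move=> Ut; rewrite phiE//; last exact: families_slab.
rewrite /slab; case: eqVneq => [->|_]; first by rewrite big_seq_fset0.
rewrite big_seq_fset1 /active /left_end /right_end /height /=.
by move: Ut; rewrite /U /= in_itv /= => ->.
Qed.

End StepFunctions.

Theorem theorem4p1 (R : realType) (n : nat) (hn : (1 <= n)%N)
    (F : set 'rV[R]_n) (h : 'rV[R]_n) :
  convex_hull F h <->
  exists S : 'I_n -> {fset rect R},
    [/\ forall i, families (S i),
        forall i, mu (S i) = h ord0 i &
        forall t, U R t -> convex_hull F (varphi t S)].
Proof.
split=> [Fh | [S [fS muS Fphi]]].
  exists (fun i => slab (h ord0 i)); split=> [i|i|t Ut].
  - exact: families_slab.
  - exact: mu_slab.
  - suff -> : varphi t (fun i => slab (h ord0 i)) = h by [].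
    by apply/rowP => i; rewrite mxE phi_slab.
pose G x : 'rV[R]_n := \row_i sweep (S i) x.
pose cuts := flatten [seq ends (S i) | i <- enum 'I_n].
have [v Fv Gv] : slope_in (convex_hull F) G 0 1.
  apply: (slope_in_cut (s := cuts)) => //; first exact: convex_set_hull.
  move=> x y x0 xy y1 cut.
  have Ux : U R x by rewrite /U /= in_itv /= x0 (lt_le_trans xy).
  exists (varphi x S); first exact: Fphi.
  apply/rowP => i; rewrite !mxE sweepB// => e ei; apply: cut.
  by apply/flatten_mapP; exists i; rewrite ?mem_enum.
suff -> : h = v by [].
move: Gv; rewrite subr0 scale1r => <-.
by apply/rowP => i; rewrite !mxE sweep0// sweep1// subr0.
Qed.
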